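(* Let $a\le -1$ be an integer. Define $b_{\mathcal{G}}(n)$, $n\ge0$, by $b_{\mathcal{G}}(0)=1$, $b_{\mathcal{G}}(1)=-1$, $b_{\mathcal{G}}(2)=a$ and, for $n\ge3$, $$b_{\mathcal{G}}(n)=-\frac12\left(\sum_{k=0}^{n-2}b_{\mathcal{G}}(k)\binom{n}{k+1}+\sum_{k=0}^{n-1}b_{\mathcal{G}}(k)\binom{n+1}{k+1}\right).$$ For integers $0\le j\le d$ set $s_{\mathcal{G}}(j,d)=\sum_{k=j}^d\frac{1}{k+1}\binom{d-j}{d-k}b_{\mathcal{G}}(k)$. Then for all $d\ge0$ and $0\le j\le d$, $s_{\mathcal{G}}(j,d)=(-1)^ds_{\mathcal{G}}(d-j,d)$. *)

(* Defs.v *)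
From HB Require Import structures.
From mathcomp Require Import all_boot all_order all_algebra.

Set Implicit Arguments.
Unset Strict Implicit.
Unset Printing Implicit Defensive.

Import Order.TTheory GRing.Theory Num.Theory.
Local Open Scope ring_scope.

Definition bG_rec (b : nat -> rat) (n : nat) : rat :=
  - (1 / 2%:R) *
    (\sum_(0 <= k < n.-1) b k * 'C(n, k.+1)%:R
     + \sum_(0 <= k < n) b k * 'C(n.+1, k.+1)%:R).

(* The recursion determines b from a; existence is bG_exists, uniqueness
   bG_unique. *)
Definition is_bG (a : int) (b : nat -> rat) : Prop :=
  [/\ b 0%N = 1, b 1%N = -1, b 2%N = a%:~R
    & forall n : nat, (3 <= n)%N -> b n = bG_rec b n].

(* Used only for j <= d, where the natural-number subtractions are exact. *)
Definition sG (b : nat -> rat) (j d : nat) : rat :=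
  \sum_(j <= k < d.+1) 1 / k.+1%:R * 'C(d - j, d - k)%:R * b k.

Lemma eq_bG_rec (b c : nat -> rat) (n : nat) :
  (forall k, (k < n)%N -> b k = c k) -> bG_rec b n = bG_rec c n.
Proof.
move=> bc; rewrite /bG_rec; congr (_ * (_ + _)).
  apply: eq_big_nat => k /andP[_ kn]; rewrite bc //.
  exact: leq_trans kn (leq_pred n).
by apply: eq_big_nat => k /andP[_ kn]; rewrite bc.
Qed.

Lemma bG_unique (a : int) (b c : nat -> rat) :
  is_bG a b -> is_bG a c -> forall n, b n = c n.
Proof.
move=> [b0 b1 b2 bS] [c0 c1 c2 cS]; elim/ltn_ind => n IH.
case: n IH => [|[|[|n]]] IH; rewrite ?b0 ?b1 ?b2 ?c0 ?c1 ?c2 //.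
by rewrite bS // cS //; exact: eq_bG_rec.
Qed.

Lemma bG_exists (a : int) : exists b : nat -> rat, is_bG a b.
Proof.
pose next (s : seq rat) := match size s with
  | 0 => 1 | 1 => -1 | 2 => a%:~R | n => bG_rec (nth 0 s) n end.
pose S := fix S n := if n is m.+1 then rcons (S m) (next (S m)) else [::].
have szS n : size (S n) = n by elim: n => //= n IH; rewrite size_rcons IH.
have nthS m n : (m < n)%N -> nth 0 (S n) m = nth 0 (S m.+1) m.
  elim: n => // n IH; rewrite ltnS leq_eqVlt => /orP[/eqP -> //|mn].
  by rewrite [S n.+1]/= nth_rcons szS mn IH.
have nthE n : nth 0 (S n.+1) n = next (S n).
  by rewrite [S n.+1]/= nth_rcons szS ltnn eqxx.
exists (fun n => nth 0 (S n.+1) n); split=> // -[|[|[|n]]] // _.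
rewrite nthE /next szS; apply: eq_bG_rec => k kn; exact: nthS.
Qed.

(* Main.v *)
Require Import Defs.
From HB Require Import structures.
From mathcomp Require Import all_boot all_order all_algebra.
From mathcomp Require Import ring lra zify.
Import Order.TTheory GRing.Theory Num.Theory.

Set Implicit Arguments.
Unset Strict Implicit.
Unset Printing Implicit Defensive.

Local Open Scope ring_scope.

(** Let [L] be the linear functional on polynomials with
    [L 'X^k = b k / (k + 1)]; then [s(j, d) = L ('X^j * ('X + 1) ^+ (d - j))],
    and the theorem says that [L] is invariant under the reflection
    ['X |-> -1 - 'X].  This is proved on ['X^n] by strong induction on [n].
    For even [n] the polynomial [('X + 1) ^+ n - 'X^n] has degree less than [n]
    and is anti-invariant, so [L] kills it, whatever the recursion.  For odd
    [n >= 3], writing [c k = L 'X^k] and [T k = L (('X + 1) ^+ k)], the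
    recursion reads [(n + 1) (c n + T n) = - n (T (n - 1) - c (n - 1))], whose
    right-hand side vanishes by the induction hypothesis. *)

Definition moment (c : nat -> rat) (p : {poly rat}) : rat :=
  \sum_(i < size p) p`_i * c i.

Definition reflX : {poly rat} := - ('X + 1).

Section Moment.

Variable c : nat -> rat.

Lemma moment_wide n (p : {poly rat}) :
  (size p <= n)%N -> moment c p = \sum_(i < n) p`_i * c i.
Proof.
move=> szp; rewrite /moment (big_ord_widen n (fun i => p`_i * c i) szp).
rewrite big_mkcond /=; apply: eq_bigr => i _.
by case: ltnP => // /(nth_default 0) ->; rewrite mul0r.
Qed.

Lemma moment_is_scalar : scalar (moment c).
Proof.
move=> k p q; set n := maxn (size p) (size q).
have szkp : (size (k *: p) <= n)%N.
  exact: leq_trans (size_scale_leq _ _) (leq_maxl _ _).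
have szq : (size q <= n)%N := leq_maxr _ _.
have szD : (size (k *: p + q)%R <= n)%N.
  by rewrite (leq_trans (size_polyD _ _)) // geq_max szkp.
rewrite (moment_wide szD) (moment_wide (leq_maxl _ _ : size p <= n)%N).
rewrite (moment_wide szq) mulr_sumr -big_split /=; apply: eq_bigr => i _.
by rewrite coefD coefZ mulrDl mulrA.
Qed.

HB.instance Definition _ :=
  GRing.isLinear.Build rat {poly rat} rat *%R (moment c) moment_is_scalar.

Lemma momentXn n : moment c 'X^n = c n.
Proof.
rewrite /moment size_polyXn big_ord_recr /= big1 => [|i _].
  by rewrite coefXn eqxx mul1r add0r.
by rewrite coefXn ltn_eqF ?mul0r.
Qed.

Lemma momentXnD1 m n :
  moment c ('X^m * ('X + 1) ^+ n) = \sum_(i < n.+1) 'C(n, i)%:R * c (m + i)%N.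
Proof.
rewrite exprD1n mulr_sumr linear_sum /=; apply: eq_bigr => i _.
by rewrite mulrnAr -exprD raddfMn /= momentXn mulr_natl.
Qed.

(** As [reflX ^+ k] is ['X^k \Po reflX], linearity carries the invariance from monomials to [p]. *)
Lemma moment_reflX n (p : {poly rat}) :
    (forall k, (k < n)%N -> moment c (reflX ^+ k) = c k) ->
  (size p <= n)%N -> moment c (p \Po reflX) = moment c p.
Proof.
move=> cn szp; rewrite comp_polyE linear_sum /= [RHS]/moment.
apply: eq_bigr => i _; rewrite linearZ /= cn //.
exact: leq_trans (ltn_ord i) szp.
Qed.

Lemma moment_reflX_even n :
    ~~ odd n -> (forall k, (k < n)%N -> moment c (reflX ^+ k) = c k) ->
  moment c (reflX ^+ n) = c n.
Proof.
move=> n_even cn; set q : {poly rat} := ('X + 1) ^+ n - 'X^n.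
have even_oppX (x : {poly rat}) : (- x) ^+ n = x ^+ n.
  by rewrite exprNn -signr_odd (negbTE n_even) mul1r.
have szq : (size q <= n)%N.
  (* The top term of the binomial expansion cancels against ['X^n]. *)
  rewrite /q exprD1n big_ord_recr /= binn addrK.
  apply: (leq_trans (size_sum _ _ _)); apply/bigmax_leqP => i _.
  by rewrite -scaler_nat (leq_trans (size_scale_leq _ _)) // size_polyXn.
(* The reflection sends ['X + 1] to [- 'X] and ['X] to [- ('X + 1)]; the even exponent absorbs the
   signs, so the two powers trade places. *)
have qN : q \Po reflX = - q.
  rewrite /q comp_polyB comp_Xn_poly rmorphXn /= comp_polyD comp_polyX.
  by rewrite comp_polyC /reflX opprD addrNK -opprD opprB !even_oppX.
have := moment_reflX cn szq; rewrite qN linearN /= => Lq.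
have /eqP : moment c q = 0 by lra.
by rewrite /q linearB /= momentXn subr_eq0 /reflX even_oppX => /eqP.
Qed.

End Moment.

Section SequenceG.

Variable b : nat -> rat.

Let c k := b k / k.+1%:R.

(** Since (k+1) C(m+1, k+1) = (m+1) C(m, k), each summand is (m+1) C(m, k) [c k]; the absent term k
    = m of the expansion is [c m]. Both sums of [bG_rec b n] have this shape, with m = n-1 and m =
    n. *)
Lemma sum_bin_moment m :
  \sum_(0 <= k < m) b k * 'C(m.+1, k.+1)%:R =
  m.+1%:R * (moment c (('X + 1) ^+ m) - c m).
Proof.
have := momentXnD1 c 0 m; rewrite mul1r => ->.
rewrite big_ord_recr /= binn mul1r addrK mulr_sumr big_mkord.
apply: eq_bigr => k _; rewrite add0n /c.
have k0 : k.+1%:R != 0 :> rat by rewrite pnatr_eq0.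
by rewrite [RHS]mulrA -natrM mul_bin_diag natrM [RHS]mulrC mulrA divfK.
Qed.

Lemma sG_moment j d : (j <= d)%N ->
  sG b j d = moment c ('X^j * ('X + 1) ^+ (d - j)).
Proof.
move=> jd; rewrite momentXnD1 /sG -{1}[j]add0n big_addn subSn // big_mkord.
apply: eq_bigr => i _; have i_le : (i <= d - j)%N by rewrite -ltnS.
have -> : (d - (i + j) = d - j - i)%N by lia.
by rewrite bin_sub // addnC /c mul1r; ring.
Qed.

Lemma moment_reflX_odd n :
    (0 < n)%N -> odd n -> b n = bG_rec b n -> moment c (reflX ^+ n.-1) = c n.-1 ->
  moment c (reflX ^+ n) = c n.
Proof.
case: n => // m _ /= m_even; rewrite /bG_rec /= !sum_bin_moment.
have reflXm : reflX ^+ m = ('X + 1) ^+ m.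
  by rewrite exprNn -signr_odd (negbTE m_even) mul1r.
have -> : reflX ^+ m.+1 = - ('X + 1) ^+ m.+1.
  by rewrite exprS reflXm mulNr -exprS.
rewrite reflXm linearN /= => bE Tm.
rewrite Tm subrr mulr0 add0r in bE.
have m0 : m.+2%:R != 0 :> rat by rewrite pnatr_eq0.
have bc : b m.+1 = m.+2%:R * c m.+1 by rewrite mulrC /c divfK.
apply: (mulfI m0); rewrite bc in bE; lra.
Qed.

Lemma moment_bG_reflX (a : int) n : is_bG a b -> moment c (reflX ^+ n) = c n.
Proof.
move=> [b0 b1 _ bS]; elim/ltn_ind: n => n IHn.
have [n_odd|n_even] := boolP (odd n); last exact: moment_reflX_even.
case: n n_odd IHn => [|[|[|n]]] // n_odd IHn; last first.
  by apply: moment_reflX_odd => //; [exact: bS | exact: IHn].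
(* The case n = 1 precedes the recursion and rests on the initial values: [c 0] = 1 and [c 1] = -1/2
   give -([c 0] + [c 1]) = [c 1]. *)
have := momentXnD1 c 0 1; rewrite mul1r /reflX !expr1 linearN /= => ->.
by rewrite big_ord_recl big_ord1 /= /bump /= /c b0 b1 bin0 bin1 !add0n addn0; lra.
Qed.

End SequenceG.

Theorem mainTheorem15 (a : int) (ha : a <= -1)
    (b : nat -> rat) (hb : is_bG a b) (d j : nat) (hj : (j <= d)%N) :
  sG b j d = (-1) ^+ d * sG b (d - j) d.
Proof.
rewrite !sG_moment ?leq_subr // subKn //.
(* Only the left side is reflected: this exchanges ['X] and ['X + 1] up to sign, and the j + (d - j)
   signs multiply to (-1)^d. *)
rewrite -(moment_reflX (fun k _ => moment_bG_reflX k hb) (leqnn (size _))).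
rewrite comp_polyM comp_Xn_poly rmorphXn /= comp_polyD comp_polyX comp_polyC.
rewrite /reflX opprD addrNK -opprD.
rewrite [(- ('X + 1)) ^+ j]exprNn [(- 'X) ^+ _]exprNn.
rewrite mulrACA -exprD subnKC //.
by rewrite -(rmorph_sign polyC) mul_polyC linearZ /= [_ ^+ j * _]mulrC.
Qed.
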